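(* Let $\hat{P}$ be a \textsc{Promela} sketch whose holes are $\texttt{??}_1,\ldots,\texttt{??}_n$, where hole $\texttt{??}_i$ has bounded integer domain $[n_i,n_i']$. Let $\varphi$ be a control function for $\hat{P}$, and let $A_1,\ldots,A_n$ be the numerical features corresponding to the holes $\texttt{??}_1,\ldots,\texttt{??}_n$ (feature $A_i$ has domain $[n_i,n_i']$). Define the configuration $k$ by $k(A_i)=\varphi(\texttt{??}_i)$ for $1\le i\le n$. Let $\overline{P}=\texttt{Rewrite}(\hat{P})$. Then $[\![\hat{P}]\!]^{\varphi}_{TS}$ is equivalent to $[\![\pi_k([\![\overline{P}]\!]_{FTS})]\!]_{TS}$.
   Context: \textsc{Promela} statements are generated by: $stm ::= \texttt{skip} \mid \texttt{break} \mid x := expr \mid c?x \mid c!expr \mid stm_1; stm_2 \mid \texttt{if}::g_1\to stm_1 \cdots ::g_n\to stm_n\ \texttt{fi} \mid \texttt{do}::g_1\to stm_1\cdots::g_n\to stm_n\ \texttt{od}$, with the standard \textsc{Promela} (SPIN) semantics, under which a model denotes a transition system (TS) $(S,I,\mathit{trans},AP,L)$; the semantics $[\![\mathcal{T}]\!]_{TS}$ of a TS is its set of infinite paths starting in an initial state. A sketch is a \textsc{Promela} model that may additionally contain integer holes $\texttt{??}_i$ (expressions), each uniquely labelled and with a bounded integer domain $[n_i,n_i']$. A control function $\varphi$ maps each hole to an integer value; $[\![\hat{P}]\!]^{\varphi}_{TS}$ is the TS of the model obtained by replacing each hole $\texttt{??}_i$ by $\varphi(\texttt{??}_i)$. Model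 families: a finite ordered set $\mathbb{F}$ of numerical features, each $A$ with domain $\mathrm{dom}(A)\subseteq\mathbb{Z}$; a configuration is a valuation $k:\mathbb{F}\to\mathbb{Z}$ with $k(A)\in\mathrm{dom}(A)$. Feature expressions: $\psi ::= \mathrm{true}\mid A\bowtie n\mid\neg\psi\mid\psi\land\psi$ with $\bowtie\in\{=,<\}$, $n\in\mathbb{Z}$. A \textsc{Promela} model family additionally allows the statement $\texttt{\#if}::\psi_1\to stm_1\ldots::\psi_n\to stm_n\ \texttt{\#endif}$ (a compile-time choice: $stm_i$ is included in the variant for configuration $k$ when $k\models\psi_i$). A model family denotes a featured transition system (FTS) $[\![\overline{P}]\!]_{FTS}=(S,I,\mathit{trans},AP,L,\mathbb{F},\mathbb{K},\delta)$, i.e. a TS together with features, a set $\mathbb{K}$ of valid configurations, and a total map $\delta$ labelling each transition with a feature expression (the presence conditions introduced by \texttt{\#if}). The projection $\pi_k(\mathcal{F})$ of an FTS to configuration $k$ is the TS $(S,I,\{t\in\mathit{trans}\mid k\models\delta(t)\},AP,L)$. $\texttt{Rewrite}(\hat{P})$ is the model family obtained by repeatedly applying, until no longer applicable, the rule: a basic (non-compound) statement $stm[\texttt{??}^{[n,n']}]$ containing a hole with domain $[n,n']$ is replaced by $\texttt{\#if}::(A=n)\to stm[n]\ \ldots\ ::(A=n')\to stm[n']\ \texttt{\#endif}$, where $A$ is a fresh numerical feature with domain $[n,n']$; the set $\mathbb{K}$ of valid configurations consists of all combinations of feature values. *)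

(* Defs.v *)
(* Plain MathComp. *)
From HB Require Import structures.
From mathcomp Require Import all_boot all_order all_algebra.
From Stdlib Require Import Relations.Relation_Operators.

Set Implicit Arguments.
Unset Strict Implicit.
Unset Printing Implicit Defensive.

Import Order.TTheory GRing.Theory Num.Theory.

(** * Feature expressions *)

(* A configuration is given by its values on all feature names; only the values
   on the features of the model family at hand are relevant. *)
Definition feature : Type := nat.
Definition config : Type := feature -> int.

Inductive fexp : Type :=
| FTrue
| FEq (A : feature) (n : int)
| FLt (A : feature) (n : int)
| FNot (psi : fexp)
| FAnd (psi1 psi2 : fexp).

Definition FOr (psi1 psi2 : fexp) : fexp :=
  FNot (FAnd (FNot psi1) (FNot psi2)).

Fixpoint fsat (k : config) (psi : fexp) : bool :=
  match psi with
  | FTrue => true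
  | FEq A n => k A == n
  | FLt A n => (k A < n)%R
  | FNot p => ~~ fsat k p
  | FAnd p q => fsat k p && fsat k q
  end.

(** * Syntax *)

Inductive binop : Type :=
  OAdd | OSub | OMul | ODiv | OMod | OEq | ONe | OLt | OLe | OGt | OGe
| OAnd | OOr.

(* Variables and channels are numbered.  [H] is the type of holes: expressions
   without holes are those over [void]. *)
Inductive expr (H : Type) : Type :=
| EConst (n : int)
| EVar (x : nat)
| EHole (h : H)
| ENot (e : expr H)
| EOpp (e : expr H)
| EBin (o : binop) (e1 e2 : expr H).

(* The basic (non-compound) executable statements.  [BTest e] is the expression
   statement, executable when [e] is nonzero; it is the usual form of a guard. *)
Inductive basic (H : Type) : Type :=
| BSkip
| BTest (e : expr H)
| BAssign (x : nat) (e : expr H)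
| BRecv (c x : nat)
| BSend (c : nat) (e : expr H).

(* As in SPIN, a guard is a statement and [g -> s] means [g; s]: the options of
   [SIf] and [SDo] are the pairs [(g, s)].  The argument of type [V] makes
   [SHashIf] unusable when [V] is [void]. *)
Inductive stm (H V : Type) : Type :=
| SBasic (b : basic H)
| SBreak
| SSeq (s1 s2 : stm H V)
| SIf (os : seq (stm H V * stm H V))
| SDo (os : seq (stm H V * stm H V))
| SHashIf (v : V) (os : seq (fexp * stm H V)).

Arguments EConst {H} n.
Arguments EVar {H} x.
Arguments BSkip {H}.
Arguments BRecv {H} c x.
Arguments SBasic {H V} b.
Arguments SBreak {H V}.

(* Global variables with their initial values, channels with their capacities
   (capacity 0 is rendezvous), and the bodies of the active processes.  Local
   variables are global variables used by a single process. *)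
Record model (H V : Type) : Type := Model {
  vars : seq int;
  chans : seq nat;
  procs : seq (stm H V)
}.

(* A hole: its label and the bounds of its domain. *)
Definition hole : Type := (nat * (int * int))%type.
Definition label (h : hole) : nat := h.1.
Definition lo (h : hole) : int := h.2.1.
Definition hi (h : hole) : int := h.2.2.

Definition promela : Type := model void void.
Definition sketch : Type := model hole void.

(* The features are listed in order, each with the bounds of its domain. *)
Record model_family : Type := Family {
  fam_model : model void unit;
  fam_feats : seq (feature * (int * int))
}.

(** * Holes and substitution *)

Fixpoint expr_holes (H : Type) (e : expr H) : seq H :=
  match e with
  | EConst _ | EVar _ => [::]
  | EHole h => [:: h]
  | ENot e1 | EOpp e1 => expr_holes e1
  | EBin _ e1 e2 => expr_holes e1 ++ expr_holes e2
  end.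

Definition basic_holes (H : Type) (b : basic H) : seq H :=
  match b with
  | BSkip | BRecv _ _ => [::]
  | BTest e | BAssign _ e | BSend _ e => expr_holes e
  end.

Fixpoint stm_holes (H V : Type) (s : stm H V) : seq H :=
  match s with
  | SBasic b => basic_holes b
  | SBreak => [::]
  | SSeq s1 s2 => stm_holes s1 ++ stm_holes s2
  | SIf os | SDo os =>
      flatten (map (fun o => stm_holes o.1 ++ stm_holes o.2) os)
  | SHashIf _ os => flatten (map (fun o => stm_holes o.2) os)
  end.

Definition model_holes (H V : Type) (P : model H V) : seq H :=
  flatten (map (@stm_holes H V) (procs P)).

Fixpoint expr_subst (H H' : Type) (f : H -> expr H') (e : expr H) : expr H' :=
  match e with
  | EConst n => EConst n
  | EVar x => EVar x
  | EHole h => f h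
  | ENot e1 => ENot (expr_subst f e1)
  | EOpp e1 => EOpp (expr_subst f e1)
  | EBin o e1 e2 => EBin o (expr_subst f e1) (expr_subst f e2)
  end.

Definition basic_subst (H H' : Type) (f : H -> expr H') (b : basic H) :
    basic H' :=
  match b with
  | BSkip => BSkip
  | BTest e => BTest (expr_subst f e)
  | BAssign x e => BAssign x (expr_subst f e)
  | BRecv c x => BRecv c x
  | BSend c e => BSend c (expr_subst f e)
  end.

Fixpoint stm_subst (H H' V V' : Type) (f : H -> expr H') (g : V -> V')
    (s : stm H V) : stm H' V' :=
  match s with
  | SBasic b => SBasic (basic_subst f b)
  | SBreak => SBreak
  | SSeq s1 s2 => SSeq (stm_subst f g s1) (stm_subst f g s2)
  | SIf os => SIf (map (fun o => (stm_subst f g o.1, stm_subst f g o.2)) os)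
  | SDo os => SDo (map (fun o => (stm_subst f g o.1, stm_subst f g o.2)) os)
  | SHashIf v os => SHashIf (g v) (map (fun o => (o.1, stm_subst f g o.2)) os)
  end.

Definition model_subst (H H' V V' : Type) (f : H -> expr H') (g : V -> V')
    (P : model H V) : model H' V' :=
  Model (vars P) (chans P) (map (stm_subst f g) (procs P)).

(* A control function is given on hole labels. *)
Definition control_function (P : sketch) (phi : nat -> int) : Prop :=
  forall h, h \in model_holes P -> (lo h <= phi (label h) <= hi h)%R.

Definition fill_holes (phi : nat -> int) (P : sketch) : promela :=
  model_subst (fun h => EConst (phi (label h))) id P.

(** * Rewriting a sketch into a model family *)

Definition zrange (m n : int) : seq int :=
  if (m <= n)%R then [seq (m + i%:Z)%R | i <- iota 0 `|(n - m)%R|%N.+1]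
  else [::].

Definition replace_hole (h : hole) (n : int) : basic hole -> basic hole :=
  basic_subst (fun h' => if h' == h then EConst n else EHole h').

(* Intermediate results may contain both holes and #if statements.  [A] names
   the features: [A i] is the feature introduced for the hole labelled [i], also
   when the rule meets several copies of that hole, created by having first
   rewritten another hole of the same basic statement. *)
Inductive stm_step (A : nat -> feature) :
    stm hole unit -> stm hole unit -> Prop :=
| step_basic b h : h \in basic_holes b ->
    stm_step A (SBasic b)
      (SHashIf tt [seq (FEq (A (label h)) n, SBasic (replace_hole h n b))
                  | n <- zrange (lo h) (hi h)])
| step_seql s1 s1' s2 : stm_step A s1 s1' ->
    stm_step A (SSeq s1 s2) (SSeq s1' s2)
| step_seqr s1 s2 s2' : stm_step A s2 s2' ->
    stm_step A (SSeq s1 s2) (SSeq s1 s2')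
| step_if_guard os1 g g' s os2 : stm_step A g g' ->
    stm_step A (SIf (os1 ++ (g, s) :: os2)) (SIf (os1 ++ (g', s) :: os2))
| step_if_body os1 g s s' os2 : stm_step A s s' ->
    stm_step A (SIf (os1 ++ (g, s) :: os2)) (SIf (os1 ++ (g, s') :: os2))
| step_do_guard os1 g g' s os2 : stm_step A g g' ->
    stm_step A (SDo (os1 ++ (g, s) :: os2)) (SDo (os1 ++ (g', s) :: os2))
| step_do_body os1 g s s' os2 : stm_step A s s' ->
    stm_step A (SDo (os1 ++ (g, s) :: os2)) (SDo (os1 ++ (g, s') :: os2))
| step_hashif v os1 psi s s' os2 : stm_step A s s' ->
    stm_step A (SHashIf v (os1 ++ (psi, s) :: os2))
               (SHashIf v (os1 ++ (psi, s') :: os2)).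

Inductive model_step (A : nat -> feature) :
    model hole unit -> model hole unit -> Prop :=
| step_proc vs cs ps1 s s' ps2 : stm_step A s s' ->
    model_step A (Model vs cs (ps1 ++ s :: ps2))
                 (Model vs cs (ps1 ++ s' :: ps2)).

Definition sketch_embed (P : sketch) : model hole unit :=
  model_subst (@EHole hole) (of_void unit) P.

Definition family_embed (P : model void unit) : model hole unit :=
  model_subst (of_void (expr hole)) id P.

(* A model is in normal form for the rule exactly when it has no hole left, that
   is, when it is of the form [family_embed Q].  The rule may be applied in any
   order; different orders may nest the #if statements differently. *)
Definition is_rewrite (A : nat -> feature) (P : sketch) (Pbar : model_family) : Prop :=
  clos_refl_trans _ (model_step A)
    (sketch_embed P) (family_embed (fam_model Pbar)) /\
  fam_feats Pbar = [seq (A (label h), (lo h, hi h)) | h <- model_holes P].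

(** * Transition systems *)

Record TS (S AP : Type) : Type := MkTS {
  ts_init : S -> Prop;
  ts_trans : S -> S -> Prop;
  ts_label : S -> AP -> Prop
}.

Definition paths (S AP : Type) (T : TS S AP) (pi : nat -> S) : Prop :=
  ts_init T (pi 0) /\ forall i, ts_trans T (pi i) (pi i.+1).

Definition ts_equiv (S AP : Type) (T1 T2 : TS S AP) : Prop :=
  forall pi : nat -> S, paths T1 pi <-> paths T2 pi.

(* The values of [fts_delta] outside the transitions of [fts_ts] are
   irrelevant. *)
Record FTS (S AP : Type) : Type := MkFTS {
  fts_ts : TS S AP;
  fts_features : seq feature;
  fts_valid : config -> Prop;
  fts_delta : S -> S -> fexp
}.

Definition projection (S AP : Type) (F : FTS S AP) (k : config) : TS S AP :=
  MkTS (ts_init (fts_ts F))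
       (fun s s' => ts_trans (fts_ts F) s s' /\ fsat k (fts_delta F s s'))
       (ts_label (fts_ts F)).

(** * Evaluation of expressions *)

(* Integer division truncates towards zero, as in C; a quotient by zero (a
   run-time error in SPIN) is given the value zero. *)
Definition quot (m n : int) : int := (sgz m * sgz n * (`|m| %/ `|n|)%N%:Z)%R.

Definition int_of_bool (b : bool) : int := (nat_of_bool b)%:Z.

Definition binop_eval (o : binop) (m n : int) : int :=
  match o with
  | OAdd => (m + n)%R
  | OSub => (m - n)%R
  | OMul => (m * n)%R
  | ODiv => quot m n
  | OMod => (m - n * quot m n)%R
  | OEq => int_of_bool (m == n)
  | ONe => int_of_bool (m != n)
  | OLt => int_of_bool (m < n)%R
  | OLe => int_of_bool (m <= n)%R
  | OGt => int_of_bool (n < m)%R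
  | OGe => int_of_bool (n <= m)%R
  | OAnd => int_of_bool ((m != 0%R) && (n != 0%R))
  | OOr => int_of_bool ((m != 0%R) || (n != 0%R))
  end.

Fixpoint eval (vs : seq int) (e : expr void) : int :=
  match e with
  | EConst n => n
  | EVar x => nth 0%R vs x
  | EHole h => of_void int h
  | ENot e1 => int_of_bool (eval vs e1 == 0%R)
  | EOpp e1 => (- eval vs e1)%R
  | EBin o e1 e2 => binop_eval o (eval vs e1) (eval vs e2)
  end.

(** * Control flow *)

(* Control locations are the addresses of the nodes of the syntax tree of the
   process body (innermost index first), and [None] for termination. *)
Definition addr : Type := seq nat.
Definition loc : Type := option addr.

(* Presence condition, statement executed, target location. *)
Definition edge : Type := (fexp * basic void * loc)%type.

Definition present (psi : fexp) (es : seq edge) : seq edge :=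
  [seq (FAnd psi e.1.1, e.1.2, e.2) | e <- es].

Definition flatmapi (T U : Type) (f : nat -> T -> seq U) : nat -> seq T -> seq U :=
  fix go i ts := if ts is t :: ts' then f i t ++ go i.+1 ts' else [::].

(* In the next three functions, [a] is the address of [s], [ex] the location
   that follows [s], and [br] the target of a break: the location that follows
   the innermost enclosing loop (termination outside of all loops).

   [entry] is the location at which [s] starts: break and sequential composition
   only define structure and have no location of their own. *)
Fixpoint entry (V : Type) (s : stm void V) (a : addr) (ex br : loc) : loc :=
  match s with
  | SBasic _ | SIf _ | SDo _ | SHashIf _ _ => Some a
  | SBreak => br
  | SSeq s1 s2 => entry s1 (0 :: a) (entry s2 (1 :: a) ex br) br
  end.

(* The first steps of [s].  An option of a selection or repetition starts at the
   location of the latter, and an alternative of #if, a compile-time choice, at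
   the location of the #if (where control blocks if no alternative is included).
   A break that comes first there is a jump, which
   takes a step of its own, as in SPIN. *)
Fixpoint first (V : Type) (s : stm void V) (a : addr) (ex br : loc) : seq edge :=
  match s with
  | SBasic b => [:: (FTrue, b, ex)]
  | SBreak => [:: (FTrue, BSkip, br)]
  | SSeq s1 s2 => first s1 (0 :: a) (entry s2 (1 :: a) ex br) br
  | SIf os =>
      flatmapi (fun i o =>
        first o.1 (0 :: i :: a) (entry o.2 (1 :: i :: a) ex br) br) 0 os
  | SDo os =>
      flatmapi (fun i o =>
        first o.1 (0 :: i :: a) (entry o.2 (1 :: i :: a) (Some a) ex) ex) 0 os
  | SHashIf _ os =>
      flatmapi (fun i o => present o.1 (first o.2 (i :: a) ex br)) 0 os
  end.

(* All the edges of [s], each with its source. *)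
Fixpoint edges (V : Type) (s : stm void V) (a : addr) (ex br : loc) :
    seq (loc * edge) :=
  let here := [seq (Some a, e) | e <- first s a ex br] in
  match s with
  | SBasic _ => here
  | SBreak => [::]
  | SSeq s1 s2 =>
      edges s1 (0 :: a) (entry s2 (1 :: a) ex br) br ++ edges s2 (1 :: a) ex br
  | SIf os =>
      here ++ flatmapi (fun i o =>
        edges o.1 (0 :: i :: a) (entry o.2 (1 :: i :: a) ex br) br ++
        edges o.2 (1 :: i :: a) ex br) 0 os
  | SDo os =>
      here ++ flatmapi (fun i o =>
        edges o.1 (0 :: i :: a) (entry o.2 (1 :: i :: a) (Some a) ex) ex ++
        edges o.2 (1 :: i :: a) (Some a) ex) 0 os
  | SHashIf _ os =>
      here ++ flatmapi (fun i o =>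
        [seq (e.1, (FAnd o.1 e.2.1.1, e.2.1.2, e.2.2))
        | e <- edges o.2 (i :: a) ex br]) 0 os
  end.

Definition out_edges (V : Type) (body : stm void V) (l : loc) : seq edge :=
  [seq e.2 | e <- edges body [::] None None & e.1 == l].

(** * Semantics of models and model families *)

(* Values of the variables and contents of the channels. *)
Definition store : Type := (seq int * seq (seq int))%type.

(* Location of each process, and store. *)
Definition state : Type := (seq loc * store)%type.

(* A send on a full channel blocks; rendezvous is treated separately. *)
Definition exec (caps : seq nat) (b : basic void) (m : store) : option store :=
  let: (vs, cs) := m in
  match b with
  | BSkip => Some m
  | BTest e => if eval vs e == 0%R then None else Some m
  | BAssign x e => Some (set_nth 0%R vs x (eval vs e), cs)
  | BRecv c x =>
      if nth [::] cs c is n :: q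
      then Some (set_nth 0%R vs x n, set_nth [::] cs c q) else None
  | BSend c e =>
      let q := nth [::] cs c in
      if size q < nth 0 caps c
      then Some (vs, set_nth [::] cs c (rcons q (eval vs e))) else None
  end.

(* The edges of process [i] from its current location. *)
Definition current_edges (V : Type) (P : model void V) (s : state) (i : nat) :
    seq edge :=
  out_edges (nth (SBasic BSkip) (procs P) i) (nth None s.1 i).

(* Steps of process [i] alone. *)
Definition local_moves (V : Type) (P : model void V) (s : state) (i : nat) :
    seq (fexp * state) :=
  pmap (fun e : edge =>
    if exec (chans P) e.1.2 s.2 is Some m
    then Some (e.1.1, (set_nth None s.1 i e.2, m)) else None)
  (current_edges P s i).

(* A send of process [i] and a receive of process [j], executed jointly. *)
Definition handshake (caps : seq nat) (s : state) (i j : nat) (e d : edge) :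
    option (fexp * state) :=
  match e.1.2, d.1.2 with
  | BSend c v, BRecv c' x =>
      if [&& i != j, c == c' & nth 0 caps c == 0]
      then Some (FAnd e.1.1 d.1.1,
                 (set_nth None (set_nth None s.1 i e.2) j d.2,
                  (set_nth 0%R s.2.1 x (eval s.2.1 v), s.2.2)))
      else None
  | _, _ => None
  end.

Definition handshakes (V : Type) (P : model void V) (s : state) (i : nat) :
    seq (fexp * state) :=
  flatten [seq pmap (fun ed => handshake (chans P) s i j ed.1 ed.2)
                    [seq (e, d) | e <- current_edges P s i,
                                  d <- current_edges P s j]
          | j <- iota 0 (size (procs P))].

Definition moves (V : Type) (P : model void V) (s : state) : seq (fexp * state) :=
  flatten [seq local_moves P s i ++ handshakes P s i
          | i <- iota 0 (size (procs P))].

Definition initial_state (V : Type) (P : model void V) : state :=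
  ([seq entry body [::] None None | body <- procs P],
   (vars P, [seq [::] | c <- chans P])).

(* Atomic propositions are the expressions over the variables. *)
Definition ap : Type := expr void.

(* Presence conditions are ignored here: those of a model without #if contain no
   feature and are all true. *)
Definition model_TS (V : Type) (P : model void V) : TS state ap :=
  MkTS (fun s => s = initial_state P)
       (fun s s' => s' \in [seq m.2 | m <- moves P s])
       (fun s e => eval s.2.1 e != 0%R).

(* A transition is present when one of the moves that realize it is. *)
Definition family_FTS (P : model_family) : FTS state ap :=
  MkFTS (model_TS (fam_model P))
        (map fst (fam_feats P))
        (fun k => forall A m n,
           (A, (m, n)) \in fam_feats P -> (m <= k A <= n)%R)
        (fun s s' => foldr FOr (FNot FTrue)
           [seq m.1 | m <- moves (fam_model P) s & m.2 == s']).

(* Main.v *)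
(* Replacing a basic statement by a #if keeps its location: the #if starts where
   the statement started, and under [k] exactly one of its alternatives is
   included, the one in which the hole is replaced by its value under [phi].  So
   each rewriting step, with the remaining holes filled by [phi], preserves the
   edges that are enabled under [k], up to their presence conditions.  The
   exceptions are the edges that start at a location strictly inside a #if:
   these locations are new, but no edge leads to them from outside, so that they
   do not occur on paths. *)
Require Import Defs.
From mathcomp Require Import all_boot all_order all_algebra.
From Stdlib Require Import Relations.Relation_Operators.
From Stdlib Require Lists.List.

Set Implicit Arguments.
Unset Strict Implicit.
Unset Printing Implicit Defensive.

Import Order.TTheory GRing.Theory Num.Theory.

(** * Induction on statements and existence in lists of edges *)

Section StmInd.
Variables (H V : Type) (P : stm H V -> Prop).
Hypothesis P_basic : forall b, P (SBasic b).
Hypothesis P_break : P SBreak.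
Hypothesis P_seq : forall s1 s2, P s1 -> P s2 -> P (SSeq s1 s2).
Hypothesis P_if :
  forall os, List.Forall (fun o => P o.1 /\ P o.2) os -> P (SIf os).
Hypothesis P_do :
  forall os, List.Forall (fun o => P o.1 /\ P o.2) os -> P (SDo os).
Hypothesis P_hashif :
  forall v os, List.Forall (fun o => P o.2) os -> P (SHashIf v os).

(** Options are nested in lists, and the inner fixpoints supply the induction hypotheses for all of
    them. *)
Fixpoint stm_nested_ind (s : stm H V) : P s :=
  let fix options os : List.Forall (fun o => P o.1 /\ P o.2) os :=
    if os is o :: os'
    then List.Forall_cons o
           (conj (stm_nested_ind o.1) (stm_nested_ind o.2)) (options os')
    else List.Forall_nil _ in
  match s with
  | SBasic b => P_basic b
  | SBreak => P_break
  | SSeq s1 s2 => P_seq (stm_nested_ind s1) (stm_nested_ind s2)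
  | SIf os => P_if (options os)
  | SDo os => P_do (options os)
  | SHashIf v os =>
      P_hashif v
        ((fix alternatives os : List.Forall (fun o => P o.2) os :=
          if os is o :: os'
          then List.Forall_cons o (stm_nested_ind o.2) (alternatives os')
          else List.Forall_nil _) os)
  end.
End StmInd.

(** Edges carry no decidable equality here, so the existence of an edge is stated as [has F] for an
    arbitrary [F]. This form hands the induction hypothesis [R] to the option that provides the
    edge. *)
Lemma has_flatmapi T U (f : nat -> T -> seq U) (R : T -> Prop) (F : pred U) i s :
  List.Forall R s -> has F (flatmapi f i s) ->
  exists j o, [/\ onth s j = Some o, R o & has F (f (i + j) o)].
Proof.
move=> Rs; elim: Rs i => //= x t Rx _ IHt i; rewrite has_cat => /orP[Fx|/IHt].
  by exists 0, x; rewrite addn0.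
by move=> [j [o [tj Ro Fo]]]; exists j.+1, o; rewrite addnS -addSn.
Qed.

Lemma flatmapi_has T U (f : nat -> T -> seq U) (F : pred U) i s j o :
  onth s j = Some o -> has F (f (i + j) o) -> has F (flatmapi f i s).
Proof.
elim: s i j => [|x s IHs] i [|j] //=; rewrite has_cat.
  by case=> ->; rewrite addn0 => ->.
by rewrite addnS -addSn => sj Fo; rewrite (IHs _ _ sj Fo) orbT.
Qed.

Lemma nth_map_onth T U (g : T -> U) d s j o :
  onth s j = Some o -> nth d (map g s) j = g o.
Proof. by move=> oj; apply: onth_nth; rewrite onth_map oj. Qed.

Lemma has_filterI T (p q : pred T) s : has p (filter q s) = has (predI q p) s.
Proof. by elim: s => //= x s <-; case: (q x). Qed.

Lemma has_flatten_map T U (p : pred U) (f : T -> seq U) s :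
  has p (flatten (map f s)) = has (fun x => has p (f x)) s.
Proof. by elim: s => //= x s <-; rewrite has_cat. Qed.

Lemma has_pmap T U (p : pred U) (f : T -> option U) s :
  has p (pmap f s) = has (fun x => oapp p false (f x)) s.
Proof. by elim: s => //= x s <-; case: (f x). Qed.

Lemma has_andl T (c : bool) (p : pred T) s :
  has (fun x => c && p x) s = c && has p s.
Proof. by case: c => //; apply: has_pred0. Qed.

(** * Outer edges and visible locations *)

(* The edges that do not start strictly inside a #if: only the case of
   [SHashIf] differs from [edges]. *)
Fixpoint outer_edges (V : Type) (s : stm void V) (a : addr) (ex br : loc) :
    seq (loc * edge) :=
  let here := [seq (Some a, e) | e <- first s a ex br] in
  match s with
  | SBasic _ | SHashIf _ _ => here
  | SBreak => [::]
  | SSeq s1 s2 =>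
      outer_edges s1 (0 :: a) (entry s2 (1 :: a) ex br) br ++
      outer_edges s2 (1 :: a) ex br
  | SIf os =>
      here ++ flatmapi (fun i o =>
        outer_edges o.1 (0 :: i :: a) (entry o.2 (1 :: i :: a) ex br) br ++
        outer_edges o.2 (1 :: i :: a) ex br) 0 os
  | SDo os =>
      here ++ flatmapi (fun i o =>
        outer_edges o.1 (0 :: i :: a) (entry o.2 (1 :: i :: a) (Some a) ex) ex ++
        outer_edges o.2 (1 :: i :: a) (Some a) ex) 0 os
  end.

(* [p] is the position, outermost index first, of a node of [s] that has a
   location and does not lie strictly inside a #if. *)
Fixpoint visible (H V : Type) (s : stm H V) (p : seq nat) : bool :=
  match s with
  | SBasic _ | SHashIf _ _ => nilp p
  | SBreak => false
  | SSeq s1 s2 => if p is c :: q then visible (if c is 0 then s1 else s2) q else false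
  | SIf os | SDo os =>
      match p with
      | [::] => true
      | [:: _] => false
      | i :: c :: q =>
          nth false [seq if c is 0 then visible o.1 q else visible o.2 q | o <- os] i
      end
  end.

(* Rewriting only produces #if statements whose alternatives are [pure]. *)
Fixpoint pure (H V : Type) (s : stm H V) : bool :=
  match s with
  | SBasic _ => true
  | SHashIf _ os => all (fun o => pure o.2) os
  | _ => false
  end.

(** Below a #if only basic statements and further #ifs are allowed, and all of these continue at the
    exit of the outermost #if. *)
Fixpoint flat (H V : Type) (s : stm H V) : bool :=
  match s with
  | SBasic _ | SBreak => true
  | SSeq s1 s2 => flat s1 && flat s2
  | SIf os | SDo os => all (fun o => flat o.1 && flat o.2) os
  | SHashIf _ os => all (fun o => pure o.2) os
  end.

(** * Targets of edges *)

(** Positions are read outermost index first, addresses innermost index first, whence [rev p]. *)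
Definition reaches (V : Type) (s : stm void V) (a : addr) (ex br t : loc) : Prop :=
  [\/ t = ex, t = br | exists2 p, visible s p & t = Some (rev p ++ a)].

Lemma reaches_sub V (s s1 : stm void V) pre a ex br ex1 br1 t :
  (forall p, visible s1 p -> visible s (pre ++ p)) ->
  reaches s a ex br ex1 -> reaches s a ex br br1 ->
  reaches s1 (rev pre ++ a) ex1 br1 t -> reaches s a ex br t.
Proof.
move=> vis r_ex r_br [-> // | -> // | [p vp ->]].
by apply: Or33; exists (pre ++ p); [apply: vis | rewrite rev_cat catA].
Qed.

Lemma entry_reaches V (s : stm void V) a ex br :
  reaches s a ex br (entry s a ex br).
Proof.
elim/stm_nested_ind: s a ex br => [b||s1 s2 IH1 IH2|os _|os _|v os _] a ex br;
  try by apply: Or33; exists [::].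
- exact: Or32.
- apply: (reaches_sub (s1 := s1) (pre := [:: 0])) (IH1 _ _ _) => //; last exact: Or32.
  apply: (reaches_sub (s1 := s2) (pre := [:: 1])) (IH2 _ _ _) => //; first exact: Or31.
  exact: Or32.
Qed.

(** Each chain of nested #ifs in a pure statement ends in one basic statement, which exits to [ex].
    Hence no first edge of a #if ends strictly inside it. *)
Lemma pure_first V (s : stm void V) a ex br (F : pred edge) :
  pure s -> has F (first s a ex br) -> exists2 e, F e & e.2 = ex.
Proof.
elim/stm_nested_ind: s a F => //= [b|v os IH] a F.
  by move=> _; rewrite orbF => Fe; exists (FTrue, b, ex).
elim: os 0 IH => //= o os IHos i /List.Forall_cons_iff[IHo IH] /andP[po pos].
rewrite has_cat has_map => /orP[/IHo|/IHos]; last exact.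
by case=> // e Fe <-; exists (FAnd o.1 e.1.1, e.1.2, e.2).
Qed.

(** Selections and loops have the same visible positions and differ only in the exits of their
    options, so one lemma serves both. The index [c] is 0 for the guard; any other value refers to
    the body. *)
Lemma reaches_body V (s : stm void V) os i o c a ex br ex1 br1 t :
  (s = SIf os \/ s = SDo os) -> onth os i = Some o ->
  reaches s a ex br ex1 -> reaches s a ex br br1 ->
  reaches (if c is 0 then o.1 else o.2) (c :: i :: a) ex1 br1 t ->
  reaches s a ex br t.
Proof.
move=> s_os oi; apply: (reaches_sub (pre := [:: i; c])) => p vp.
by case: s_os => -> /=; rewrite (nth_map_onth _ _ oi); case: c vp.
Qed.

Lemma reaches_guard V (s : stm void V) os i o a ex br ex1 br1 t :
  (s = SIf os \/ s = SDo os) -> onth os i = Some o ->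
  reaches s a ex br ex1 -> reaches s a ex br br1 ->
  reaches o.1 (0 :: i :: a) (entry o.2 (1 :: i :: a) ex1 br1) br1 t ->
  reaches s a ex br t.
Proof.
move=> s_os oi r_ex r_br; apply: (reaches_body (c := 0) s_os oi) => //.
apply: (reaches_body (c := 1) s_os oi r_ex r_br).
exact: entry_reaches.
Qed.

Lemma reaches_do V (os : seq (stm void V * stm void V)) a ex br :
  reaches (SDo os) a ex br (Some a).
Proof. by apply: Or33; exists [::]. Qed.

Lemma reaches_seq1 V (s1 s2 : stm void V) a ex br t :
  reaches s1 (0 :: a) (entry s2 (1 :: a) ex br) br t ->
  reaches (SSeq s1 s2) a ex br t.
Proof.
apply: (reaches_sub (pre := [:: 0])) => //; last exact: Or32.
apply: (reaches_sub (s1 := s2) (pre := [:: 1])) (entry_reaches _ _ _ _) => //.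
  exact: Or31.
exact: Or32.
Qed.


Section FlatInd.
Variables (H V : Type) (P : stm H V -> Prop).
Hypothesis P_basic : forall b, P (SBasic b).
Hypothesis P_break : P SBreak.
Hypothesis P_seq : forall s1 s2, P s1 -> P s2 -> P (SSeq s1 s2).
Hypothesis P_if :
  forall os, flat (SIf os) -> List.Forall (fun o => P o.1 /\ P o.2) os ->
  P (SIf os).
Hypothesis P_do :
  forall os, flat (SDo os) -> List.Forall (fun o => P o.1 /\ P o.2) os ->
  P (SDo os).
Hypothesis P_hashif :
  forall v os, flat (SHashIf v os) -> P (SHashIf v os).

(** The #if case comes without induction hypothesis, because outer edges do not descend into
    alternatives. *)
Lemma flat_ind (s : stm H V) : flat s -> P s.
Proof.
have options os :
  List.Forall (fun o => (flat o.1 -> P o.1) /\ (flat o.2 -> P o.2)) os ->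
  all (fun o => flat o.1 && flat o.2) os ->
  List.Forall (fun o => P o.1 /\ P o.2) os.
  elim: os => //= o os IHos /List.Forall_cons_iff[[P1 P2] /IHos Pos].
  by move=> /andP[/andP[/P1 ? /P2 ?] /Pos ?]; constructor.
elim/stm_nested_ind: s => //= [s1 s2 IH1 IH2|os IH|os IH|v os _].
- by move=> /andP[/IH1 ? /IH2 ?]; apply: P_seq.
- by move=> fos; apply: P_if (options _ IH fos).
- by move=> fos; apply: P_do (options _ IH fos).
- exact: P_hashif.
Qed.
End FlatInd.

Lemma first_reaches V (s : stm void V) a ex br (F : pred edge) :
  flat s -> has F (first s a ex br) ->
  exists2 e, F e & reaches s a ex br e.2.
Proof.
move=> fs; elim/flat_ind: fs a ex br F
  => [b||s1 s2 IH1 _|os _ IH|os _ IH|v os fos] a ex br F /=.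
- by rewrite orbF => Fe; exists (FTrue, b, ex) => //; apply: Or31.
- by rewrite orbF => Fe; exists (FTrue, BSkip, br) => //; apply: Or32.
- by move=> /IH1[e Fe /reaches_seq1]; exists e.
- move=> /(has_flatmapi IH)[i [o [oi [IHo _] /IHo[e Fe re]]]]; exists e => //.
  by apply: reaches_guard re; [left | exact: oi | exact: Or31 | exact: Or32].
- move=> /(has_flatmapi IH)[i [o [oi [IHo _] /IHo[e Fe re]]]]; exists e => //.
  (* The options of a loop continue at the loop itself, and their breaks lead to [ex]. *)
  by apply: reaches_guard re;
    [right | exact: oi | exact: reaches_do | exact: Or31].
- have/= := @pure_first _ (SHashIf v os) a ex br F.
  by move=> H /(H fos)[e Fe e_ex]; exists e => //; apply: Or31.
Qed.

(** This confines control to visible locations. Flatness matters at a #if, where an arbitrary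
    alternative could lead to a location of its own. *)
Lemma outer_edges_reaches V (s : stm void V) a ex br (F : pred (loc * edge)) :
  flat s -> has F (outer_edges s a ex br) ->
  exists2 e, F e & reaches s a ex br e.2.2.
Proof.
have here (s' : stm void V) a' l ex' br' (F' : pred (loc * edge)) : flat s' ->
    has F' [seq (l, e) | e <- first s' a' ex' br'] ->
    exists2 e, F' e & reaches s' a' ex' br' e.2.2.
  by move=> fs; rewrite has_map => /(first_reaches fs)[e]; exists (l, e).
move=> fs; elim/flat_ind: fs a ex br F
  => [b||s1 s2 IH1 IH2|os fos IH|os fos IH|v os fos] a ex br F //=.
- exact: (here (SBasic b) a (Some a) ex br F isT).
- rewrite has_cat.
  case/orP=> [/IH1[e Fe /reaches_seq1]|/IH2[e Fe re]]; exists e => //.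
  by apply: (reaches_sub (pre := [:: 1])) re => //; [exact: Or31 | exact: Or32].
- rewrite has_cat => /orP[|]; first exact: (here (SIf os) a (Some a) ex br F fos).
  move=> /(has_flatmapi IH)[i [o [oi [IH1 IH2]]]]; rewrite has_cat.
  case/orP=> [/IH1[e Fe re]|/IH2[e Fe re]]; exists e => //.
    by apply: reaches_guard re; [left | exact: oi | exact: Or31 | exact: Or32].
  by apply: (reaches_body (c := 1)) re;
    [left | exact: oi | exact: Or31 | exact: Or32].
- rewrite has_cat => /orP[|]; first exact: (here (SDo os) a (Some a) ex br F fos).
  move=> /(has_flatmapi IH)[i [o [oi [IH1 IH2]]]]; rewrite has_cat.
  case/orP=> [/IH1[e Fe re]|/IH2[e Fe re]]; exists e => //.
    by apply: reaches_guard re;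
      [right | exact: oi | exact: reaches_do | exact: Or31].
  by apply: (reaches_body (c := 1)) re;
    [right | exact: oi | exact: reaches_do | exact: Or31].
- exact: (here (SHashIf v os) a (Some a) ex br F fos).
Qed.

(** * Outer edges among all edges *)

Lemma outer_edges_sub V (s : stm void V) a ex br (F : pred (loc * edge)) :
  has F (outer_edges s a ex br) -> has F (edges s a ex br).
Proof.
elim/stm_nested_ind: s a ex br F
  => [b||s1 s2 IH1 IH2|os IH|os IH|v os IH] a ex br F //=; rewrite !has_cat.
- by case/orP=> [/IH1|/IH2] ->; rewrite ?orbT.
- case/orP=> [->//|h]; apply/orP; right.
  have [i [o [oi [IH1 IH2]]]] := has_flatmapi IH h.
  rewrite has_cat => h12; apply: (flatmapi_has oi); rewrite has_cat.
  by case/orP: h12 => [/IH1|/IH2] ->; rewrite ?orbT.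
- case/orP=> [->//|h]; apply/orP; right.
  have [i [o [oi [IH1 IH2]]]] := has_flatmapi IH h.
  rewrite has_cat => h12; apply: (flatmapi_has oi); rewrite has_cat.
  by case/orP: h12 => [/IH1|/IH2] ->; rewrite ?orbT.
- by move=> ->.
Qed.

(** Serves to place the edges of an alternative strictly inside its #if. *)
Lemma edges_source V (s : stm void V) a ex br (F : pred (loc * edge)) :
  has F (edges s a ex br) -> exists p e, F (Some (rev p ++ a), e).
Proof.
have here a' es (F' : pred (loc * edge)) : has F' [seq (Some a', e) | e <- es] ->
    exists p e, F' (Some (rev p ++ a'), e).
  by elim: es => //= e es IHes /orP[Fe|/IHes//]; exists [::], e.
have down pre a' (F' : pred (loc * edge)) :
    (exists p e, F' (Some (rev p ++ rev pre ++ a'), e)) ->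
    exists p e, F' (Some (rev p ++ a'), e).
  by move=> [p [e Fp]]; exists (pre ++ p), e; rewrite rev_cat -catA.
elim/stm_nested_ind: s a ex br F
  => [b||s1 s2 IH1 IH2|os IH|os IH|v os IH] a ex br F /=; rewrite ?has_cat.
- exact: (here a [:: _]).
- by [].
- by case/orP=> [/IH1|/IH2] h; [apply: (down [:: 0]) h | apply: (down [:: 1]) h].
- case/orP=> [/here//|/(has_flatmapi IH)[i [o [_ [IH1 IH2]]]]]; rewrite has_cat.
  by case/orP=> [/IH1|/IH2] h; [apply: (down [:: i; 0]) h | apply: (down [:: i; 1]) h].
- case/orP=> [/here//|/(has_flatmapi IH)[i [o [_ [IH1 IH2]]]]]; rewrite has_cat.
  by case/orP=> [/IH1|/IH2] h; [apply: (down [:: i; 0]) h | apply: (down [:: i; 1]) h].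
- case/orP=> [/here//|/(has_flatmapi IH)[i [o [_ IHo]]]]; rewrite has_map.
  by move=> /IHo[p [e Fe]]; apply: (down [:: i]); exists p; eexists; apply: Fe.
Qed.

(** Converse of [outer_edges_sub], up to edges that a process at a visible location cannot take. *)
Lemma edges_outer_or_hidden V (s : stm void V) a ex br (F : pred (loc * edge)) :
  has F (edges s a ex br) ->
  has F (outer_edges s a ex br) \/
  exists p e, ~~ visible s p /\ F (Some (rev p ++ a), e).
Proof.
have down pre (s' s1 : stm void V) a' (F' : pred (loc * edge)) :
    (forall p, visible s' (pre ++ p) = visible s1 p) ->
    (exists p e, ~~ visible s1 p /\ F' (Some (rev p ++ rev pre ++ a'), e)) ->
    exists p e, ~~ visible s' p /\ F' (Some (rev p ++ a'), e).
  move=> vis [p [e [vp Fp]]]; exists (pre ++ p), e.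
  by rewrite vis rev_cat -catA.
elim/stm_nested_ind: s a ex br F
  => [b||s1 s2 IH1 IH2|os IH|os IH|v os IH] a ex br F /=; rewrite ?has_cat.
- by left.
- by [].
- case/orP=> [/IH1|/IH2] [->|h]; rewrite ?orbT; try by left.
    by right; apply: (down [:: 0] (SSeq s1 s2) s1) h.
  by right; apply: (down [:: 1] (SSeq s1 s2) s2) h.
- case/orP=> [->|]; first by left.
  move=> /(has_flatmapi IH)[i [o [oi [IH1 IH2]]]]; rewrite has_cat.
  case/orP=> [/IH1|/IH2] [h|h].
  + left; apply/orP; right; apply: (flatmapi_has oi).
    by rewrite has_cat h.
  + right; apply: (down [:: i; 0] (SIf os) o.1) h => p /=.
    by rewrite (nth_map_onth _ _ oi).
  + left; apply/orP; right; apply: (flatmapi_has oi).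
    by rewrite has_cat h orbT.
  + right; apply: (down [:: i; 1] (SIf os) o.2) h => p /=.
    by rewrite (nth_map_onth _ _ oi).
- case/orP=> [->|]; first by left.
  move=> /(has_flatmapi IH)[i [o [oi [IH1 IH2]]]]; rewrite has_cat.
  case/orP=> [/IH1|/IH2] [h|h].
  + left; apply/orP; right; apply: (flatmapi_has oi).
    by rewrite has_cat h.
  + right; apply: (down [:: i; 0] (SDo os) o.1) h => p /=.
    by rewrite (nth_map_onth _ _ oi).
  + left; apply/orP; right; apply: (flatmapi_has oi).
    by rewrite has_cat h orbT.
  + right; apply: (down [:: i; 1] (SDo os) o.2) h => p /=.
    by rewrite (nth_map_onth _ _ oi).
- case/orP=> [->|]; first by left.
  (* An edge of alternative [i] starts at a position of the form [i :: p], whereas only [[::]] is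
     visible in a #if. *)
  move=> /(has_flatmapi IH)[i [o [oi _]]]; rewrite has_map add0n.
  move=> /edges_source[p [e Fe]]; right.
  by exists (i :: p); eexists; split; last by rewrite rev_cons cat_rcons; apply: Fe.
Qed.

Lemma outer_edges_no_hashif (s : stm void void) a ex br :
  outer_edges s a ex br = edges s a ex br.
Proof.
have eq_options (f g : nat -> stm void void * stm void void -> seq (loc * edge))
    (R : stm void void * stm void void -> Prop) i os :
    (forall i o, R o -> f i o = g i o) -> List.Forall R os ->
    flatmapi f i os = flatmapi g i os.
  move=> fg; elim: os i => //= o os IHos i /List.Forall_cons_iff[Ro Ros].
  by rewrite (fg _ _ Ro) IHos.
elim/stm_nested_ind: s a ex br => [b||s1 s2 IH1 IH2|os IH|os IH|[]] a ex br //=.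
- by rewrite IH1 IH2.
- by congr (_ ++ _); apply: eq_options IH => i o [-> ->].
- by congr (_ ++ _); apply: eq_options IH => i o [-> ->].
Qed.

(** * Statements with the same enabled outer edges *)

(** [F] does not see the presence condition, which is tested only by [c]: [xpredT] for the filled
    sketch, [fsat k] for the family. *)
Definition enabled (c : pred fexp) (F : basic void -> loc -> bool) : pred edge :=
  fun e => c e.1.1 && F e.1.2 e.2.

Lemma has_enabled_here c (F : loc -> basic void -> loc -> bool) l (es : seq edge) :
  has (fun le : loc * edge => enabled c (F le.1) le.2) [seq (l, e) | e <- es] =
  has (enabled c (F l)) es.
Proof. by rewrite has_map. Qed.

Lemma has_flatmapi2 T1 T2 U (f1 : nat -> T1 -> seq U) (f2 : nat -> T2 -> seq U)
    (R : T1 -> T2 -> Prop) (F1 F2 : pred U) i s1 s2 :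
  (forall i x1 x2, R x1 x2 -> has F1 (f1 i x1) = has F2 (f2 i x2)) ->
  List.Forall2 R s1 s2 ->
  has F1 (flatmapi f1 i s1) = has F2 (flatmapi f2 i s2).
Proof.
move=> f12 R12; elim: R12 i => //= x1 x2 t1 t2 Rx _ IHt i.
by rewrite !has_cat (f12 _ _ _ Rx) IHt.
Qed.

(** Quantifying over [F] compares sets of enabled edges and ignores order and multiplicity. Entries
    and first edges are included because the outer edges of a compound statement depend on those of
    its parts, placed at varying addresses and exits. *)
Record similar V1 V2 (c1 c2 : pred fexp) (s1 : stm void V1) (s2 : stm void V2) :
    Prop := Similar {
  similar_entry : forall a ex br, entry s1 a ex br = entry s2 a ex br;
  similar_first : forall F a ex br,
    has (enabled c1 F) (first s1 a ex br) = has (enabled c2 F) (first s2 a ex br);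
  similar_outer : forall (F : loc -> basic void -> loc -> bool) a ex br,
    has (fun e => enabled c1 (F e.1) e.2) (outer_edges s1 a ex br) =
    has (fun e => enabled c2 (F e.1) e.2) (outer_edges s2 a ex br)
}.

Lemma similar_refl V c (s : stm void V) : similar c c s s.
Proof. by []. Qed.

Lemma similar_trans V1 V2 V3 c1 c2 c3 (s1 : stm void V1) (s2 : stm void V2)
    (s3 : stm void V3) :
  similar c1 c2 s1 s2 -> similar c2 c3 s2 s3 -> similar c1 c3 s1 s3.
Proof.
move=> [e12 f12 o12] [e23 f23 o23]; split=> *.
- by rewrite e12.
- by rewrite f12.
- by rewrite o12.
Qed.

Section Congruence.
Variables (V1 V2 : Type) (c1 c2 : pred fexp).
Notation sim := (@similar V1 V2 c1 c2).

Lemma similar_seq s1 s1' s2 s2' :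
  sim s1 s1' -> sim s2 s2' -> sim (SSeq s1 s2) (SSeq s1' s2').
Proof.
move=> sim1 sim2; split=> [a ex br|F a ex br|F a ex br] /=.
- by rewrite (similar_entry sim2) (similar_entry sim1).
- by rewrite (similar_entry sim2) (similar_first sim1).
- rewrite !has_cat (similar_entry sim2) (similar_outer sim1).
  by rewrite (similar_outer sim2).
Qed.

Lemma similar_if os os' :
  List.Forall2 (fun o o' => sim o.1 o'.1 /\ sim o.2 o'.2) os os' ->
  sim (SIf os) (SIf os').
Proof.
move=> sim_os.
have sim_first F a ex br : has (enabled c1 F) (first (SIf os) a ex br) =
    has (enabled c2 F) (first (SIf os') a ex br).
  apply: has_flatmapi2 sim_os => i o o' [sim1 sim2].
  by rewrite (similar_entry sim2) (similar_first sim1).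
split=> // F a ex br; rewrite /= !has_cat !has_enabled_here.
congr (_ || _); first exact: sim_first.
apply: has_flatmapi2 sim_os => i o o' [sim1 sim2]; rewrite !has_cat.
by rewrite (similar_entry sim2) (similar_outer sim1) (similar_outer sim2).
Qed.

Lemma similar_do os os' :
  List.Forall2 (fun o o' => sim o.1 o'.1 /\ sim o.2 o'.2) os os' ->
  sim (SDo os) (SDo os').
Proof.
move=> sim_os.
have sim_first F a ex br : has (enabled c1 F) (first (SDo os) a ex br) =
    has (enabled c2 F) (first (SDo os') a ex br).
  apply: has_flatmapi2 sim_os => i o o' [sim1 sim2].
  by rewrite (similar_entry sim2) (similar_first sim1).
split=> // F a ex br; rewrite /= !has_cat !has_enabled_here.
congr (_ || _); first exact: sim_first.
apply: has_flatmapi2 sim_os => i o o' [sim1 sim2]; rewrite !has_cat.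
by rewrite (similar_entry sim2) (similar_outer sim1) (similar_outer sim2).
Qed.
End Congruence.

Lemma has_present k F psi es :
  has (enabled (fsat k) F) (present psi es) =
  fsat k psi && has (enabled (fsat k) F) es.
Proof.
rewrite has_map -has_andl; apply: eq_has => e /=.
by rewrite /enabled /= andbA.
Qed.

(** The outer edges of a #if are its first edges, so the edges hidden inside the alternatives may
    differ. *)
Lemma similar_hashif V k (v : V) os os' :
  List.Forall2 (fun o o' => o.1 = o'.1 /\
    similar (fsat k) (fsat k) o.2 o'.2) os os' ->
  similar (fsat k) (fsat k) (SHashIf v os) (SHashIf v os').
Proof.
move=> sim_os.
have sim_first F a ex br :
    has (enabled (fsat k) F) (first (SHashIf v os) a ex br) =
    has (enabled (fsat k) F) (first (SHashIf v os') a ex br).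
  apply: has_flatmapi2 sim_os => i o o' [eq_psi sim_o].
  by rewrite !has_present eq_psi (similar_first sim_o).
split=> // F a ex br.
by rewrite !has_enabled_here; apply: sim_first.
Qed.

(** * Rewriting preserves the enabled outer edges *)

Lemma mem_zrange m n x : (m <= x <= n)%R -> x \in zrange m n.
Proof.
case/andP=> mx xn; rewrite /zrange (le_trans mx xn); apply/mapP.
exists `|(x - m)%R|%N; last by rewrite gez0_abs ?subr_ge0 // addrC subrK.
rewrite mem_iota add0n ltnS /= -lez_nat !gez0_abs ?subr_ge0 ?lerD2r //.
exact: le_trans xn.
Qed.

Section Fill.
Variable phi : nat -> int.

Definition hole_value (h : hole) : expr void := EConst (phi (label h)).

Definition fill (V : Type) : stm hole V -> stm void V := stm_subst hole_value id.

Lemma expr_subst_replace (h : hole) (e : expr hole) :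
  expr_subst hole_value
    (expr_subst (fun h' => if h' == h then EConst (phi (label h)) else EHole h') e) =
  expr_subst hole_value e.
Proof.
elim: e => //= [h'|e ->//|e ->//|o e1 -> e2 ->//].
by case: eqP => [->|].
Qed.

Lemma basic_subst_replace h b :
  basic_subst hole_value (replace_hole h (phi (label h)) b) =
  basic_subst hole_value b.
Proof. by case: b => //= *; rewrite expr_subst_replace. Qed.

(** Under [k] the condition on the new feature holds only for the value of [h] under [phi]. This
    value lies in the domain of [h], and filling the other holes of that alternative gives back the
    filled [b]. *)
Lemma fill_basic_similar A k h b :
  k (A (label h)) = phi (label h) -> (lo h <= phi (label h) <= hi h)%R ->
  similar (fsat k) (fsat k) (fill (SBasic (V := unit) b))
    (fill (SHashIf tt [seq (FEq (A (label h)) n, SBasic (replace_hole h n b))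
                      | n <- zrange (lo h) (hi h)])).
Proof.
move=> k_h /mem_zrange phi_in.
(* Generalized over the list of values and the starting index, for induction on the list. *)
have first_os F i a ex br ns :
    has (enabled (fsat k) F)
      (flatmapi (fun i o => present o.1 (first o.2 (i :: a) ex br)) i
        [seq (o.1, fill o.2)
        | o <- [seq (FEq (A (label h)) n, SBasic (V := unit) (replace_hole h n b))
               | n <- ns]]) =
    (phi (label h) \in ns) && F (basic_subst hole_value b) ex.
  elim: ns i => //= n ns IHns i; rewrite IHns /enabled /= k_h in_cons.
  by case: eqP => //= <-; rewrite basic_subst_replace; case: (F _ _); rewrite ?andbF.
split=> // F a ex br; rewrite /= ?has_map ?first_os ?phi_in ?orbF //.
by have := first_os (F (Some a)) 0 a ex br (zrange (lo h) (hi h)); rewrite phi_in => ->.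
Qed.

(** Without #if every presence condition is [FTrue], so [xpredT] and [fsat k] enable the same
    edges. *)
Lemma fill_embed_similar k (s : stm hole void) :
  similar xpredT (fsat k) (fill s) (fill (stm_subst (@EHole hole) (of_void unit) s)).
Proof.
have subst_embed (e : expr hole) :
    expr_subst hole_value (expr_subst (@EHole hole) e) = expr_subst hole_value e.
  by elim: e => //= [e ->|e ->|o e1 -> e2 ->].
have options os :
  List.Forall (fun o => similar xpredT (fsat k) (fill o.1)
      (fill (stm_subst (@EHole hole) (of_void unit) o.1)) /\
    similar xpredT (fsat k) (fill o.2)
      (fill (stm_subst (@EHole hole) (of_void unit) o.2))) os ->
  List.Forall2 (fun o o' => similar xpredT (fsat k) o.1 o'.1 /\
      similar xpredT (fsat k) o.2 o'.2)
    [seq (fill o.1, fill o.2) | o <- os]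
    [seq (fill o.1, fill o.2) | o <- [seq (stm_subst (@EHole hole) (of_void unit) o.1,
      stm_subst (@EHole hole) (of_void unit) o.2) | o <- os]].
  by elim: os => //= o os IHos /List.Forall_cons_iff[sim_o /IHos]; constructor.
elim/stm_nested_ind: s => [b||s1 s2 IH1 IH2|os IH|os IH|[]].
- by split=> // *; case: b => //= *; rewrite /enabled /= ?subst_embed.
- by [].
- exact: similar_seq.
- by apply: similar_if; apply: options.
- by apply: similar_do; apply: options.
Qed.

Section Step.
Variables (A : nat -> feature) (k : config).

Definition good_hole h :=
  k (A (label h)) = phi (label h) /\ (lo h <= phi (label h) <= hi h)%R.

Lemma Forall2_middle T U (R : T -> T -> Prop) (f : U -> T) s1 x y s2 :
  (forall x, R x x) -> R (f x) (f y) ->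
  List.Forall2 R (map f (s1 ++ x :: s2)) (map f (s1 ++ y :: s2)).
Proof.
move=> Rxx Rxy; elim: s1 => [|z s1 IHs] /=; constructor => //.
by elim: s2; constructor.
Qed.

Lemma stm_step_similar s s' :
  stm_step A s s' -> (forall h, h \in stm_holes s -> good_hole h) ->
  similar (fsat k) (fsat k) (fill s) (fill s').
Proof.
have refl2 (o : stm void unit * stm void unit) :
  similar (fsat k) (fsat k) o.1 o.1 /\ similar (fsat k) (fsat k) o.2 o.2 by [].
elim=> {s s'} [b h h_b|s1 s1' s2 _ IH|s1 s2 s2' _ IH|os1 g g' s os2 _ IH
  |os1 g s s' os2 _ IH|os1 g g' s os2 _ IH|os1 g s s' os2 _ IH
  |v os1 psi s s' os2 _ IH] good.
  by have [k_h phi_h] := good h h_b; apply: fill_basic_similar.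
(* In each context rule the holes of the rewritten part are holes of the whole statement, which
   discharges the premise of the induction hypothesis. *)
all: match type of IH with _ -> ?S =>
  have {}IH : S by apply: IH => h h_s; apply: good;
    rewrite /= ?map_cat ?flatten_cat /= ?mem_cat h_s ?orbT end.
- exact: similar_seq IH (similar_refl _ _).
- exact: similar_seq (similar_refl _ _) IH.
- by apply: similar_if; apply: Forall2_middle.
- by apply: similar_if; apply: Forall2_middle.
- by apply: similar_do; apply: Forall2_middle.
- by apply: similar_do; apply: Forall2_middle.
- by apply: similar_hashif; apply: Forall2_middle.
Qed.
End Step.
End Fill.

(** * Invariants of rewriting steps *)

Section StepInvariants.
Variable A : nat -> feature.

(** Needed for steps inside an alternative, where flatness demands purity. *)
Lemma stm_step_pure s s' : stm_step A s s' -> pure s -> pure s'.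
Proof.
elim=> //= [b h _ _|v os1 psi t t' os2 _ IH].
  by rewrite all_map; elim: zrange.
by rewrite !all_cat /= => /and3P[-> /IH-> ->].
Qed.

Lemma stm_step_flat s s' : stm_step A s s' -> flat s -> flat s'.
Proof.
elim=> //= [b h _ _|s1 s1' s2 _ IH|s1 s2 s2' _ IH|os1 g g' t os2 _ IH
  |os1 g t t' os2 _ IH|os1 g g' t os2 _ IH|os1 g t t' os2 _ IH
  |v os1 psi t t' os2 st _]; rewrite ?all_cat /=.
- by rewrite all_map; elim: zrange.
- by case/andP=> /IH->.
- by case/andP=> -> /IH.
- by case/and3P=> -> /andP[/IH-> ->].
- by case/and3P=> -> /andP[-> /IH->].
- by case/and3P=> -> /andP[/IH-> ->].
- by case/and3P=> -> /andP[-> /IH->].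
- by case/and3P=> -> /(stm_step_pure st)-> ->.
Qed.

Lemma expr_holes_replace (h : hole) n (e : expr hole) :
  {subset expr_holes
      (expr_subst (fun h' => if h' == h then EConst n else EHole h') e)
    <= expr_holes e}.
Proof.
elim: e => //= [h'|o e1 IH1 e2 IH2] x; first by case: eqP.
by rewrite !mem_cat => /orP[/IH1|/IH2] ->; rewrite ?orbT.
Qed.

(** A step may copy holes but creates none, so a hypothesis on all holes of the sketch persists
    along the rewriting. *)
Lemma stm_step_holes s s' :
  stm_step A s s' -> {subset stm_holes s' <= stm_holes s}.
Proof.
elim=> {s s'} [b h _|s1 s1' s2 _ IH|s1 s2 s2' _ IH|os1 g g' t os2 _ IH
  |os1 g t t' os2 _ IH|os1 g g' t os2 _ IH|os1 g t t' os2 _ IH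
  |v os1 psi t t' os2 _ IH] x;
  rewrite /= ?map_cat ?flatten_cat /= ?mem_cat; try by
    repeat (case/orP); try move/IH; move=> ->; rewrite ?orbT.
rewrite -map_comp; elim: zrange => //= n ns IHns; rewrite mem_cat.
by case/orP=> // ; case: b {IHns} => //= *; apply: expr_holes_replace; eassumption.
Qed.
End StepInvariants.

(** * Substitutions and embeddings *)

Lemma pure_subst H H' V V' (f : H -> expr H') (g : V -> V') s :
  pure (stm_subst f g s) = pure s.
Proof.
elim/stm_nested_ind: s => //= v os IH; rewrite all_map.
by elim: IH => //= o os' -> _ ->.
Qed.

Lemma flat_subst H H' V V' (f : H -> expr H') (g : V -> V') s :
  flat (stm_subst f g s) = flat s.
Proof.
elim/stm_nested_ind: s => //= [s1 s2 -> -> //|os IH|os IH|v os _]; rewrite all_map.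
- by elim: IH => //= o os' [-> ->] _ ->.
- by elim: IH => //= o os' [-> ->] _ ->.
- by apply: eq_all => o /=; rewrite pure_subst.
Qed.

Lemma flat_no_hashif H (s : stm H void) : flat s.
Proof.
elim/stm_nested_ind: s => //= [s1 s2 ->//|os IH|os IH].
- by elim: IH => //= o os' [-> ->] _ ->.
- by elim: IH => //= o os' [-> ->] _ ->.
Qed.

Lemma stm_holes_embed (s : stm hole void) :
  stm_holes (stm_subst (@EHole hole) (of_void unit) s) = stm_holes s.
Proof.
have expr_holes_embed (e : expr hole) :
    expr_holes (expr_subst (@EHole hole) e) = expr_holes e.
  by elim: e => //= o e1 -> e2 ->.
elim/stm_nested_ind: s => //= [[]//=|s1 s2 -> -> //|os IH|os IH].
- by elim: IH => //= o os' [-> ->] _ ->.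
- by elim: IH => //= o os' [-> ->] _ ->.
Qed.

(** A normal form has no holes, so filling disappears at the end of the rewriting. *)
Lemma fill_embed_family phi (s : stm void unit) :
  fill phi (stm_subst (of_void (expr hole)) id s) = s.
Proof.
have expr_embed e : expr_subst (hole_value phi) (expr_subst (of_void (expr hole)) e) = e.
  by elim: e => //= [e ->|e ->|o e1 -> e2 ->].
rewrite /fill; elim/stm_nested_ind: s => //= [b|s1 s2 -> -> //|os IH|os IH|v os IH].
- by case: b => //= *; rewrite expr_embed.
- by congr SIf; elim: IH => //= -[o1 o2] os' [/= -> ->] _ ->.
- by congr SDo; elim: IH => //= -[o1 o2] os' [/= -> ->] _ ->.
- by congr SHashIf; elim: IH => //= -[psi o] os' /= -> _ ->.
Qed.

(** * Models *)

(* The default value is the one of [current_edges]. *)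
Definition proc (H V : Type) (P : model H V) (i : nat) : stm H V :=
  nth (SBasic BSkip) (procs P) i.

Lemma proc_subst H H' V V' (f : H -> expr H') (g : V -> V') P i :
  proc (model_subst f g P) i = stm_subst f g (proc P i).
Proof.
rewrite /proc /=; have [i_lt|i_ge] := ltnP i (size (procs P)).
  exact: nth_map.
by rewrite !nth_default ?size_map.
Qed.

(** These properties compose along a sequence of steps; [rewritten_holes] passes the hypothesis on
    holes to the later steps. *)
Record rewritten (phi : nat -> int) (k : config) (M M' : model hole unit) : Prop :=
  Rewritten {
    rewritten_vars : vars M' = vars M;
    rewritten_chans : chans M' = chans M;
    rewritten_size : size (procs M') = size (procs M);
    rewritten_similar : forall i,
      similar (fsat k) (fsat k) (fill phi (proc M i)) (fill phi (proc M' i));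
    rewritten_flat : (forall i, flat (proc M i)) -> forall i, flat (proc M' i);
    rewritten_holes : {subset model_holes M' <= model_holes M}
  }.

Lemma clos_model_step_rewritten phi A k M M' :
  clos_refl_trans _ (model_step A) M M' ->
  (forall h, h \in model_holes M -> good_hole phi A k h) ->
  rewritten phi k M M'.
Proof.
elim=> {M M'} [M M' st|M|M1 M2 M3 _ IH12 _ IH23] good.
- case: st good => vs cs ps1 s s' ps2 st good.
  have holesE t : model_holes (Model vs cs (ps1 ++ t :: ps2)) =
      flatten (map (@stm_holes _ _) ps1) ++ stm_holes t ++
      flatten (map (@stm_holes _ _) ps2).
    by rewrite /model_holes map_cat flatten_cat.
  have sim_s : similar (fsat k) (fsat k) (fill phi s) (fill phi s').
    apply: stm_step_similar st _ => h h_s; apply: good.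
    by rewrite holesE !mem_cat h_s orbT.
  split=> //=.
  + by rewrite !size_cat.
  (* Only the process at index [size ps1] changes. *)
  + move=> i; rewrite /proc /= !nth_cat.
    by case: ltnP => // _; case: (i - size ps1).
  + move=> fM i; have := fM i; rewrite /proc /= !nth_cat.
    by case: ltnP => // _; case: (i - size ps1) => //=; apply: stm_step_flat st.
  + move=> h; rewrite !holesE !mem_cat => /or3P[->|/(stm_step_holes st)->|->] //;
    by rewrite ?orbT.
- by split=> // i; apply: similar_refl.
- have [v12 c12 s12 sim12 f12 h12] := IH12 good.
  have [|v23 c23 s23 sim23 f23 h23] := IH23.
    by move=> h /h12; apply: good.
  split; [by rewrite v23 | by rewrite c23 | by rewrite s23 | |
    by move=> /f12 | by move=> h /h23 /h12].
  by move=> i; apply: similar_trans (sim12 i) (sim23 i).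
Qed.

(** * Moves *)

(** Takes a statement and a target last, to serve as the predicate [F] in [enabled]. *)
Definition moves_locally caps (s : state) i (s' : state) (b : basic void) (l : loc) :=
  if exec caps b s.2 is Some m then (set_nth None s.1 i l, m) == s' else false.

Definition moves_jointly caps (s : state) i j (s' : state)
    (b : basic void) (l : loc) (b' : basic void) (l' : loc) :=
  match b, b' with
  | BSend c v, BRecv c' x =>
      [&& i != j, c == c' & nth 0 caps c == 0] &&
      ((set_nth None (set_nth None s.1 i l) j l',
        (set_nth 0%R s.2.1 x (eval s.2.1 v), s.2.2)) == s')
  | _, _ => false
  end.

(** Moves are reduced to tests on enabled current edges, to which similarity applies. The morphism
    condition splits the conjunction that labels a handshake. *)
Lemma has_moves V (P : model void V) (c : pred fexp) s s' :
  {morph c : psi1 psi2 / FAnd psi1 psi2 >-> psi1 && psi2} ->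
  has (fun m => c m.1 && (m.2 == s')) (moves P s) =
  has (fun i =>
      has (enabled c (moves_locally (chans P) s i s')) (current_edges P s i) ||
      has (fun j =>
          has (enabled c (fun b l =>
              has (enabled c (moves_jointly (chans P) s i j s' b l))
                (current_edges P s j)))
            (current_edges P s i))
        (iota 0 (size (procs P))))
    (iota 0 (size (procs P))).
Proof.
move=> cD; rewrite /moves has_flatten_map; apply: eq_has => i.
rewrite has_cat /local_moves /handshakes has_pmap has_flatten_map; congr (_ || _).
  apply: eq_has => e; rewrite /enabled /moves_locally.
  by case: exec => //=; rewrite andbF.
apply: eq_has => j; rewrite has_pmap has_flatten_map.
apply: eq_has => e; rewrite has_map /enabled -has_andl; apply: eq_has => d /=.
rewrite /handshake /moves_jointly.
case: e.1.2 => *; case: d.1.2 => * /=; rewrite ?andbF //.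
by case: ifP => _ /=; rewrite ?andbF // cD !andbA.
Qed.

(** * Visible locations along transitions *)

Definition visible_loc (H V : Type) (s : stm H V) (l : loc) : bool :=
  if l is Some x then visible s (rev x) else true.

Lemma reaches_visible V (s : stm void V) l :
  reaches s [::] None None l -> visible_loc s l.
Proof. by case=> [->|->|[p vp ->]] //=; rewrite cats0 revK. Qed.

Definition visible_locs (V : Type) (P : model void V) (ls : seq loc) : Prop :=
  forall i, visible_loc (proc P i) (nth None ls i).

Lemma visible_locs_set V (P : model void V) ls i l :
  visible_locs P ls -> visible_loc (proc P i) l ->
  visible_locs P (set_nth None ls i l).
Proof. by move=> vis vis_l j; rewrite nth_set_nth /=; case: eqP => [->|]. Qed.

Lemma has_current_edges V (P : model void V) s i (F : pred edge) :
  has F (current_edges P s i) =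
  has (fun le => (le.1 == nth None s.1 i) && F le.2)
    (edges (proc P i) [::] None None).
Proof. by rewrite /current_edges /out_edges has_map has_filterI. Qed.

(** An edge that is not outer starts at a hidden location, hence not at the current one. *)
Lemma has_current_outer_edges V (P : model void V) s i (F : pred edge) :
  visible_locs P s.1 ->
  has F (current_edges P s i) =
  has (fun le => (le.1 == nth None s.1 i) && F le.2)
    (outer_edges (proc P i) [::] None None).
Proof.
move=> /(_ i) vis_l; rewrite has_current_edges.
apply/idP/idP => [|/outer_edges_sub //].
case/edges_outer_or_hidden => // -[p [e []]].
rewrite cats0 /= => /negP hid /andP[/eqP l_p _].
by move: vis_l; rewrite -l_p /= revK => /hid.
Qed.

Lemma current_edges_visible V (P : model void V) s i (F : pred edge) :
  flat (proc P i) -> visible_locs P s.1 -> has F (current_edges P s i) ->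
  exists2 e, F e & visible_loc (proc P i) e.2.
Proof.
move=> fP vis; rewrite has_current_outer_edges // => /(outer_edges_reaches fP).
by case=> -[l e] /andP[_ Fe] /reaches_visible vis_e; exists e.
Qed.

Lemma model_trans V (P : model void V) s s' :
  ts_trans (model_TS P) s s' <->
  has (fun m => xpredT m.1 && (m.2 == s')) (moves P s).
Proof. by rewrite /= -has_pred1 has_map. Qed.

(** A transition executes one or two current edges, and their targets are visible by flatness. *)
Lemma trans_visible V (P : model void V) s s' :
  (forall i, flat (proc P i)) -> ts_trans (model_TS P) s s' ->
  visible_locs P s.1 -> visible_locs P s'.1.
Proof.
move=> fP /model_trans s_s' vis; move: s_s'.
rewrite (@has_moves V P xpredT) // => /hasP[i _ /orP[|/hasP[j _]]].
  case/(current_edges_visible (fP i) vis) => e /andP[_].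
  rewrite /moves_locally; case: exec => // m /eqP<- vis_e.
  exact: visible_locs_set.
case/(current_edges_visible (fP i) vis) => e /andP[_].
case/(current_edges_visible (fP j) vis) => d /andP[_].
rewrite /moves_jointly; case: e.1.2 => //; case: d.1.2 => // c x c' v.
case/andP=> _ /eqP<- vis_d vis_e.
by apply: visible_locs_set vis_d; apply: visible_locs_set.
Qed.

Lemma initial_visible V (P : model void V) : visible_locs P (initial_state P).1.
Proof.
move=> i; rewrite /proc /=; have [i_lt|i_ge] := ltnP i (size (procs P)).
  by rewrite (nth_map (SBasic BSkip)) //; apply/reaches_visible/entry_reaches.
by rewrite (nth_default None) ?size_map.
Qed.

(** * Transitions of the projection *)

Lemma fsat_foldr_FOr k psis :
  fsat k (foldr FOr (FNot FTrue) psis) = has (fsat k) psis.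
Proof. by elim: psis => //= psi psis ->; rewrite negb_and !negbK. Qed.

(** The label of a transition is the disjunction over the moves that realize it. *)
Lemma projection_trans (P : model_family) k s s' :
  ts_trans (projection (family_FTS P) k) s s' <->
  has (fun m => fsat k m.1 && (m.2 == s')) (moves (fam_model P) s).
Proof.
rewrite /= fsat_foldr_FOr has_map has_filterI -has_pred1 has_map.
split=> [[_ h]|h]; last split; apply: sub_has h => m /andP[] //= h1 h2;
  exact/andP.
Qed.

Lemma similar_trans_iff V1 (P1 : model void V1) (P2 : model_family) k s s' :
  chans P1 = chans (fam_model P2) ->
  size (procs P1) = size (procs (fam_model P2)) ->
  (forall i (F : basic void -> loc -> bool),
    has (enabled xpredT F) (current_edges P1 s i) =
    has (enabled (fsat k) F) (current_edges (fam_model P2) s i)) ->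
  ts_trans (model_TS P1) s s' <->
  ts_trans (projection (family_FTS P2) k) s s'.
Proof.
move=> eq_chans eq_size eq_edges; rewrite model_trans projection_trans.
rewrite (@has_moves _ P1 xpredT) // (@has_moves _ _ (fsat k)) // eq_chans eq_size.
set b1 := has _ _; set b2 := has _ _; suff -> : b1 = b2 by [].
apply: eq_has => i; rewrite eq_edges; congr (_ || _); apply: eq_has => j.
(* The first rewriting replaces the edges of process [i], the second those of its partner [j]. *)
by rewrite eq_edges; apply: eq_has => e; rewrite /enabled eq_edges.
Qed.

Lemma model_holes_embed P : model_holes (sketch_embed P) = model_holes P.
Proof.
by rewrite /model_holes -map_comp; congr flatten; apply: eq_map => s;
  apply: stm_holes_embed.
Qed.

(* [A i] is the feature corresponding to the hole labelled [i]; distinct holes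
   get distinct features. *)
Theorem theorem2 (P : sketch) (phi : nat -> int) (A : nat -> feature)
    (k : config) (Pbar : model_family)
    (uniq_labels : uniq [seq label h | h <- model_holes P])
    (phi_control : control_function P phi)
    (A_fresh : {in [seq label h | h <- model_holes P] &, injective A})
    (k_def : forall h, h \in model_holes P -> k (A (label h)) = phi (label h))
    (Pbar_def : is_rewrite A P Pbar) :
  fts_valid (family_FTS Pbar) k /\
  ts_equiv (model_TS (fill_holes phi P)) (projection (family_FTS Pbar) k).
Proof.
case: Pbar_def => rewr feats; split=> [B m n|].
  rewrite feats => /mapP[h h_P [-> -> ->]]; rewrite k_def //.
  exact: phi_control.
set Q := fam_model Pbar in rewr *.
have [|eq_vars eq_chans eq_size sim_QP flatQ _] :=
    @clos_model_step_rewritten phi A k _ _ rewr.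
  move=> h; rewrite model_holes_embed => h_P.
  by split; [exact: k_def | exact: phi_control].
have {}flatQ i : flat (proc Q i).
  have := flatQ _ i; rewrite proc_subst flat_subst; apply=> j.
  by rewrite proc_subst flat_subst flat_no_hashif.
(* The filled sketch is similar to its filled embedding, and this to the filled normal form, which
   is [Q]. *)
have {sim_QP}sim i : similar xpredT (fsat k) (proc (fill_holes phi P) i) (proc Q i).
  have := sim_QP i; rewrite !proc_subst fill_embed_family.
  by apply: similar_trans; apply: fill_embed_similar.
rewrite /= !size_map in eq_size.
(* Visibility is required because [Q] may have further edges starting inside a #if. *)
have trans_iff s s' : visible_locs Q s.1 ->
    ts_trans (model_TS (fill_holes phi P)) s s' <->
    ts_trans (projection (family_FTS Pbar) k) s s'.
  move=> vis; apply: similar_trans_iff; rewrite ?size_map // => i F.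
  rewrite has_current_edges has_current_outer_edges // -outer_edges_no_hashif.
  (* The test on the source is moved into the predicate, which [similar_outer] allows to depend on
     the source. *)
  pose G (l : loc) b l' := (l == nth None s.1 i) && F b l'.
  have swap c (e : loc * edge) :
      (e.1 == nth None s.1 i) && enabled c F e.2 = enabled c (G e.1) e.2.
    exact: andbCA.
  rewrite (eq_has (swap _)) (eq_has (swap _)).
  exact: similar_outer (sim i) _ _ _ _.
have init : initial_state (fill_holes phi P) = initial_state Q.
  rewrite /initial_state eq_vars eq_chans; congr (_, _).
  apply: (@eq_from_nth _ None); rewrite !size_map // => i i_lt.
  rewrite !(nth_map (SBasic BSkip)) ?size_map ?eq_size //.
  by have := similar_entry (sim i) [::] None None; rewrite proc_subst.
have vis0 := initial_visible Q.
move=> pi; split=> -[pi0 steps]; rewrite /= in pi0.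
(* Visibility refers to [Q], so each step is first carried over to the projection, which the
   invariant at the current state permits. *)
- have vis i : visible_locs Q (pi i).1.
    elim: i => [|i IHi]; first by rewrite pi0 init.
    by apply: trans_visible (IHi) => //; have [] := (trans_iff _ _ IHi).1 (steps i).
  by split=> [|i]; [rewrite /= pi0 init | exact/trans_iff].
- have vis i : visible_locs Q (pi i).1.
    elim: i => [|i IHi]; first by rewrite pi0.
    by apply: trans_visible (IHi) => //; have [] := steps i.
  by split=> [|i]; [rewrite /= pi0 init | exact/trans_iff].
Qed.
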